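(* Let $p$ be a prime, $n\ge 1$, and let $\sigma,\tau\in\mathcal{B}_n(\mathbb{F}_p)$ be of maximal orbit, i.e. $$\sigma=(x_1+\lambda_1,\ x_2+\lambda_2x_1^{p-1}+g_2,\ x_3+\lambda_3(x_1x_2)^{p-1}+g_3,\ \ldots,\ x_n+\lambda_n(x_1\cdots x_{n-1})^{p-1}+g_n),$$ $$\tau=(x_1+\mu_1,\ x_2+\mu_2x_1^{p-1}+h_2,\ x_3+\mu_3(x_1x_2)^{p-1}+h_3,\ \ldots,\ x_n+\mu_n(x_1\cdots x_{n-1})^{p-1}+h_n),$$ where $\lambda_i,\mu_i\in\mathbb{F}_p^*$ and $g_i,h_i\in R_{i-1}^-$. Then there exists $\varphi\in\mathcal{B}_n(\mathbb{F}_p)$ such that $\varphi^{-1}\sigma\varphi=\tau$ if and only if $\lambda_i=\mu_i$ for all $1\le i\le n$. If such $\varphi$ exists, then one may additionally assume $\varphi$ to be in standard form, and then $\varphi$ is unique.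
   Context: $R_j:=\mathbb{F}_p[X_1,\ldots,X_j]/(X_1^p-X_1,\ldots,X_j^p-X_j)=\mathbb{F}_p[x_1,\ldots,x_j]$ is identified with the ring of functions $\mathbb{F}_p^j\to\mathbb{F}_p$ ($R_0=\mathbb{F}_p$). $R_j^-$ is the $\mathbb{F}_p$-linear subspace of $R_j$ spanned by all monomials $x_1^{\alpha_1}\cdots x_j^{\alpha_j}$ with $0\le\alpha_i\le p-1$ and $(\alpha_1,\ldots,\alpha_j)\neq(p-1,\ldots,p-1)$. $\mathcal{B}_n(\mathbb{F}_p)$ is the group (under composition) of all permutations of $\mathbb{F}_p^n$ of the form $\sigma=(x_1+g_1,\ldots,x_n+g_n)$ with $g_i\in R_{i-1}$ for $1\le i\le n$. Such $\sigma$ is of maximal orbit if it consists of one permutation cycle of length $p^n$; it is known that this holds if and only if for each $1\le i\le n$ the coefficient of $x_1^{p-1}\cdots x_{i-1}^{p-1}$ in $g_i$ is nonzero. An element $\varphi\in\mathcal{B}_n(\mathbb{F}_p)$ is in standard form if $\varphi(0,0,\ldots,0)=(1,0,\ldots,0)$. *)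

(* Defs.v *)
From HB Require Import structures.
From mathcomp Require Import all_boot all_order all_algebra all_fingroup.

Set Implicit Arguments.
Unset Strict Implicit.
Unset Printing Implicit Defensive.

Import GRing.Theory.
Local Open Scope ring_scope.

(* Coordinates are indexed from 0: the mathematical x_(i+1), g_(i+1), ... are
   the entries of index i : 'I_n, so that g_(i+1) lies in R_i. *)

(* R_j, as the ring of functions F_p^j -> F_p.  The codomain is the regular
   module of 'F_p so that the library makes R_j a vector space over 'F_p. *)
Definition R (p j : nat) := {ffun 'rV['F_p]_j -> ('F_p)^o}.

Definition monomial (p j : nat) (a : {ffun 'I_j -> 'I_p}) : R p j :=
  [ffun x : 'rV['F_p]_j => \prod_(k < j) x 0 k ^+ a k].

(* R_j^-.  For j = 0 the only exponent is excluded, so this is the zero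
   space. *)
Definition Rminus (p j : nat) : {vspace R p j} :=
  (\sum_(a : {ffun 'I_j -> 'I_p} | ~~ [forall k, a k == p.-1 :> nat])
     <[monomial a]>)%VS.

(* (x_1 ... x_j)^(p-1); equal to 1 for j = 0. *)
Definition top_monomial (p j : nat) : R p j :=
  [ffun x : 'rV['F_p]_j => (\prod_(k < j) x 0 k) ^+ p.-1].

Definition first_coords (p n : nat) (i : 'I_n) (x : 'rV['F_p]_n) : 'rV['F_p]_i :=
  \row_(k < i) x 0 (widen_ord (ltnW (ltn_ord i)) k).

Definition triangular (p n : nat) (g : forall i : 'I_n, R p i)
    (x : 'rV['F_p]_n) : 'rV['F_p]_n :=
  \row_(i < n) (x 0 i + g i (first_coords i x)).

(* B_n(F_p); see Bn_P for the form using triangular. *)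
Definition Bn (p n : nat) : {set {perm 'rV['F_p]_n}} :=
  [set s : {perm 'rV['F_p]_n} |
    [forall i : 'I_n, [exists g : R p i,
      [forall x : 'rV['F_p]_n, s x 0 i == x 0 i + g (first_coords i x)]]]].

Lemma Bn_P (p n : nat) (s : {perm 'rV['F_p]_n}) :
  reflect (exists g : forall i : 'I_n, R p i, s =1 triangular g)
          (s \in Bn p n).
Proof.
rewrite inE; apply: (iffP forallP) => [H | [g Hg] i]; last first.
  by apply/existsP; exists (g i); apply/forallP=> x; rewrite Hg mxE.
exists (fun i => xchoose (existsP (H i))) => x.
apply/rowP=> i; rewrite mxE.
by have /forallP/(_ x)/eqP := xchooseP (existsP (H i)).
Qed.

Lemma Bn_group_set (p n : nat) : group_set (Bn p n).
Proof.
apply/group_setP; split=> [|s t /Bn_P[g Hg] /Bn_P[h Hh]].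
  apply/Bn_P; exists (fun i => 0) => x.
  by apply/rowP=> i; rewrite perm1 mxE ffunE addr0.
pose lift i (y : 'rV['F_p]_i) : 'rV['F_p]_n :=
  \row_(k < n) (if insub (val k) is Some l then y 0 l else 0).
have liftK (i : 'I_n) x (k : 'I_n) : (k < i)%N -> lift i (first_coords i x) 0 k = x 0 k.
  move=> ki; rewrite mxE insubT /= mxE; congr (x 0 _); exact: val_inj.
have pre_s (i : 'I_n) x : first_coords i (triangular g (lift i (first_coords i x))) =
                  first_coords i (triangular g x).
  apply/rowP=> k; rewrite !mxE.
  set k' := widen_ord _ k; have ki : (k' < i)%N by exact: ltn_ord k.
  rewrite -(liftK _ x _ ki) mxE; congr (_ + g k' _).
  apply/rowP=> l; rewrite !(mxE _ _ 0 l).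
  by apply: liftK; apply: ltn_trans ki; exact: ltn_ord l.
apply/Bn_P; exists (fun i => [ffun y => g i y +
  h i (first_coords i (triangular g (lift i y)))]) => x.
apply/rowP=> i; rewrite permM Hh Hg !mxE ffunE pre_s.
by rewrite addrA.
Qed.

Canonical Bn_group (p n : nat) := Group (@Bn_group_set p n).

Definition maximal_orbit (p n : nat) (s : {perm 'rV['F_p]_n}) : Prop :=
  exists C : {set 'rV['F_p]_n}, porbits s = [set C] /\ #|C| = (p ^ n)%N.

Definition standard_form (p n : nat) (s : {perm 'rV['F_p]_n}) : Prop :=
  s 0 = \row_(i < n) (i == 0 :> nat)%:R.

(* phi^-1 sigma phi = tau as a composition of maps, the rightmost one being
   applied first.  It is spelled out with \o because the product of {perm _}
   composes in the opposite order. *)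
Definition conj_maps_to (p n : nat) (phi sigma tau : {perm 'rV['F_p]_n}) : Prop :=
  (phi^-1)%g \o sigma \o phi =1 tau.

(* Main.v *)
Require Import Defs.
From HB Require Import structures.
From mathcomp Require Import all_boot all_order all_algebra all_fingroup.
From mathcomp Require Import finfield.

Set Implicit Arguments.
Unset Strict Implicit.
Unset Printing Implicit Defensive.

Import GRing.Theory.
Local Open Scope ring_scope.

(* A monomial of R_i other than the top one sums to 0 over F_p^i, while the top
   one sums to (-1)^i; so (-1)^i lambda_(i+1) is the sum of all values of the
   last component of sigma at level i+1.  As sigma is a full cycle, sigma^(p^i)
   fixes the first i coordinates and adds exactly this sum to the next one.
   The maps phi with phi tau = sigma phi are phi (tau^k 0) = sigma^k e, where
   e = phi 0 is arbitrary.  Two points with the same first i coordinates have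
   the form z and tau^(m p^i) z, and phi sends them to phi z and
   sigma^(m p^i) (phi z); hence the increment phi(x) - x in coordinate i + 1
   depends only on the first i coordinates of x iff the two shifts agree. *)

(** * Periodic enumerations of a finite type *)

Section PeriodicEnumeration.

Variables (T : finType) (f : nat -> T).
Hypothesis f_period : forall k, f (k + #|T|)%N = f k.
Hypothesis f_onto : forall y, exists k, f k = y.

Lemma periodic_modn k : f (k %% #|T|) = f k.
Proof.
rewrite [in RHS](divn_eq k #|T|) addnC; elim: (k %/ #|T|)%N => [|q IHq].
  by rewrite mul0n addn0.
by rewrite mulSn addnCA addnC f_period.
Qed.

(** Periodicity moves every index below [#|T|], so these indices already reach all of [T]; a
    surjection between finite sets of equal size is bijective. *)
Lemma periodic_ord_bij : bijective (fun k : 'I_#|T| => f k).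
Proof.
apply: inj_card_bij; last by rewrite card_ord.
have T_gt0 : (0 < #|T|)%N by apply/card_gt0P; exists (f 0).
suff /image_injP inj_f : #|image (fun k : 'I_#|T| => f k) 'I_#|T| | == #|'I_#|T| |.
  by move=> k l; exact: inj_f.
rewrite card_ord; apply/eqP/eq_card => y; rewrite [RHS]inE.
have [k <-] := f_onto y; apply/imageP.
by exists (Ordinal (ltn_pmod k T_gt0)); rewrite //= periodic_modn.
Qed.

Lemma periodic_eq k l : (f k = f l) <-> (k = l %[mod #|T|])%N.
Proof.
split=> [|kl]; last by rewrite -periodic_modn kl periodic_modn.
have T_gt0 : (0 < #|T|)%N by apply/card_gt0P; exists (f 0).
rewrite -(periodic_modn k) -(periodic_modn l) => fkl.
have := bij_inj periodic_ord_bij.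
move=> /(_ (Ordinal (ltn_pmod k T_gt0)) (Ordinal (ltn_pmod l T_gt0)) fkl).
by move=> /(congr1 val).
Qed.

Lemma periodic_sum (V : nmodType) (F : T -> V) :
  \sum_(k < #|T|) F (f k) = \sum_y F y.
Proof. by rewrite [RHS](reindex _ (onW_bij _ periodic_ord_bij)). Qed.

End PeriodicEnumeration.

(** * Power sums over finite fields *)

(** Translation by 1 permutes [F], so adding 1 to each element keeps the total, and the added ones
    sum to 0. *)
Lemma natr_card_finRing (F : finNzRingType) : #|F|%:R = 0 :> F.
Proof.
have : \sum_(t : F) t = \sum_(t : F) (1 + t) by rewrite (reindex_inj (addrI 1)).
by rewrite big_split sumr_const -[LHS]add0r => /addIr.
Qed.

(** For positive [a], the substitution of u t for t multiplies the sum by u^a, so any nonzero u with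
    u^a different from 1 forces it to vanish. *)
Lemma sum_expr_finField (F : finFieldType) (a : nat) :
  (a < #|F|.-1)%N -> \sum_(t : F) t ^+ a = 0.
Proof.
move=> a_lt; have [->|a_gt0] := posnP a.
  under eq_bigr do rewrite expr0.
  by rewrite sumr_const natr_card_finRing.
(* Otherwise all [#|F|.-1] nonzero elements would be roots of X^a - 1, which has at most [a] of
   them. *)
have [u u_neq0 ua] : exists2 u : F, u != 0 & u ^+ a != 1.
  apply/exists_inP; apply: contraLR a_lt => /exists_inPn ua.
  rewrite -leqNgt -(cardC1 (0 : F)) cardE.
  apply: (max_unity_roots a_gt0 _ (enum_uniq (predC1 (0 : F)))).
  apply/allP=> t; rewrite mem_enum => /ua; rewrite negbK => /eqP ta.
  by apply/unity_rootP.
apply: (mulfI (x := 1 - u ^+ a)); first by rewrite subr_eq0 eq_sym.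
rewrite mulr0 mulrBl mul1r; apply/eqP; rewrite subr_eq0; apply/eqP.
rewrite big_distrr [LHS](reindex_inj (mulfI u_neq0)) /=.
by apply: eq_bigr => t _; rewrite exprMn.
Qed.

Lemma sum_expr_pred_card (F : finFieldType) :
  \sum_(t : F) t ^+ #|F|.-1 = -1.
Proof.
have q_gt0 : (0 < #|F|.-1)%N by rewrite -subn1 subn_gt0 finNzRing_gt1.
rewrite (bigD1 0) //= expr0n gtn_eqF // add0r.
rewrite (eq_bigr (fun=> 1)) => [|t t_neq0]; last first.
  apply: (mulfI t_neq0); rewrite -exprS prednK ?expf_card ?mulr1 //.
  exact: ltnW (finNzRing_gt1 F).
apply: (addrI 1); rewrite subrr -[RHS](natr_card_finRing F) -sumr_const.
by rewrite [RHS](bigD1 0).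
Qed.

(** * Sums of monomials over F_p^j *)

Section SumsOverRowVectors.

Variables p j : nat.
Hypothesis p_pr : prime p.

Lemma sum_rV_prod (V : comPzRingType) (F : 'I_j -> 'F_p -> V) :
  \sum_(y : 'rV['F_p]_j) \prod_(k < j) F k (y 0 k) =
  \prod_(k < j) \sum_(t : 'F_p) F k t.
Proof.
rewrite bigA_distr_bigA /=.
rewrite (reindex (fun f : {ffun 'I_j -> 'F_p} => \row_k f k)) /=; last first.
  exists (fun y => [ffun k => y 0 k]) => [f|y] _.
    by apply/ffunP=> k; rewrite ffunE mxE.
  by apply/rowP=> k; rewrite mxE ffunE.
by apply: eq_bigr => f _; apply: eq_bigr => k _; rewrite mxE.
Qed.

(** The sum of a monomial factors into one-variable power sums; a monomial other than the top one
    has an exponent below p - 1, whose factor is 0. *)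
Lemma sum_Rminus (g : R p j) :
  g \in Rminus p j -> \sum_(y : 'rV['F_p]_j) g y = 0.
Proof.
move=> /memv_sumP[v vP ->].
under eq_bigr do rewrite sum_ffunE.
rewrite exchange_big big1 //= => a a_top.
have /vlineP[c ->] := vP a a_top.
under eq_bigr do rewrite !ffunE.
rewrite -[LHS]/(\sum_(y : 'rV['F_p]_j) c * \prod_(k < j) y 0 k ^+ a k).
rewrite -big_distrr /= (sum_rV_prod (fun k t => t ^+ a k)).
move: a_top; rewrite negb_forall => /existsP[k ak].
rewrite (bigD1 k) //= sum_expr_finField ?mul0r ?mulr0 //.
rewrite card_Fp // ltn_neqAle ak -ltnS prednK ?prime_gt0 //.
exact: ltn_ord.
Qed.

Lemma sum_top_monomial :
  \sum_(y : 'rV['F_p]_j) top_monomial p j y = (-1) ^+ j.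
Proof.
under eq_bigr do rewrite ffunE -prodrXl.
rewrite (sum_rV_prod (fun _ t => t ^+ p.-1)).
have := sum_expr_pred_card 'F_p; rewrite card_Fp // => ->.
by rewrite prodr_const card_ord.
Qed.

Lemma sum_top_Rminus (c : 'F_p) (g : R p j) : g \in Rminus p j ->
  \sum_(y : 'rV['F_p]_j) (c *: top_monomial p j + g) y = c * (-1) ^+ j.
Proof.
move=> gP; under eq_bigr do rewrite !ffunE.
rewrite big_split /= sum_Rminus // addr0 -sum_top_monomial big_distrr.
by apply: eq_bigr => y _; rewrite ffunE.
Qed.

End SumsOverRowVectors.

Lemma card_rV_Fp (p j : nat) : prime p -> #|{: 'rV['F_p]_j}| = (p ^ j)%N.
Proof. by move=> p_pr; rewrite card_mx card_Fp // mul1n. Qed.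

(** * Initial coordinates and iteration of triangular maps *)

Lemma first_coordsP (p n : nat) (i : 'I_n) (x y : 'rV['F_p]_n) :
  (forall k : 'I_n, (k < i)%N -> x 0 k = y 0 k) <->
  first_coords i x = first_coords i y.
Proof.
split=> [xy | /rowP xy k ki].
  by apply/rowP=> k; rewrite !mxE xy //= ltn_ord.
have := xy (Ordinal ki); rewrite !mxE.
by have -> : widen_ord (ltnW (ltn_ord i)) (Ordinal ki) = k by exact: val_inj.
Qed.

Lemma first_coords_onto (p n : nat) (i : 'I_n) (y : 'rV['F_p]_i) :
  exists x : 'rV['F_p]_n, first_coords i x = y.
Proof.
exists (\row_k if insub (val k) is Some l then y 0 l else 0).
by apply/rowP=> k; rewrite !mxE /= valK.
Qed.

Section TriangularIteration.

Variables p n : nat.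
Hypothesis p_pr : prime p.
Variable G : forall i : 'I_n, R p i.
Local Notation s := (triangular G).

Lemma iter_triangular m x i :
  iter m s x 0 i = x 0 i + \sum_(k < m) G i (first_coords i (iter k s x)).
Proof.
elim: m => [|m IHm]; first by rewrite big_ord0 addr0.
by rewrite big_ord_recr /= addrA -IHm mxE.
Qed.

Lemma first_coords_triangular i x y :
  first_coords i x = first_coords i y ->
  first_coords i (s x) = first_coords i (s y).
Proof.
move=> /first_coordsP xy; apply/first_coordsP => k ki.
rewrite !mxE xy //; congr (_ + G k _).
by apply/first_coordsP=> l lk; apply: xy; apply: ltn_trans ki.
Qed.

Lemma first_coords_iter m i x y :
  first_coords i x = first_coords i y ->
  first_coords i (iter m s x) = first_coords i (iter m s y).
Proof. by move=> xy; elim: m => //= m; exact: first_coords_triangular. Qed.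

(** Induction on [j]: the p^j-th iterate fixes the coordinates of index below [j], so each
    repetition of it adds the same amount to coordinate [j], and p repetitions add 0. *)
Lemma triangular_period j (k : 'I_n) x :
  (k < j)%N -> iter (p ^ j) s x 0 k = x 0 k.
Proof.
elim: j k x => // j IHj k x; rewrite ltnS leq_eqVlt expnS iterM.
case/predU1P=> [kj|kj]; last first.
  have fix_k m : iter m (iter (p ^ j) s) x 0 k = x 0 k.
    by elim: m => //= m <-; rewrite IHj.
  exact: fix_k.
pose c y : 'F_p := \sum_(l < p ^ j) G k (first_coords k (iter l s y)).
have c_iter m : first_coords k (iter m (iter (p ^ j) s) x) = first_coords k x.
  elim: m => //= m <-; apply/first_coordsP => l lk.
  by rewrite IHj // -kj.
have {}IHj m : iter m (iter (p ^ j) s) x 0 k = x 0 k + c x *+ m.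
  elim: m => [|m IHm] /=; first by rewrite addr0.
  rewrite iter_triangular IHm mulrSr addrA; congr (_ + _).
  by apply: eq_bigr => l _; congr (G k _); exact: first_coords_iter.
by rewrite IHj (mulrn_pchar (pchar_Fp p_pr)) addr0.
Qed.

Section Transitive.

Hypothesis s_trans : forall x y, exists k, iter k s x = y.

(** The orbit has period p^n and visits all p^n points, hence each of them once per period. *)
Lemma iter_triangular_eq x k l :
  iter k s x = iter l s x <-> (k = l %[mod p ^ n])%N.
Proof.
rewrite -card_rV_Fp //; apply: (periodic_eq (f := fun k => iter k s x)) => // m.
rewrite card_rV_Fp // iterD; congr (iter m s _); apply/rowP=> i.
by rewrite triangular_period.
Qed.

Let f (i : 'I_n) x k : 'rV['F_p]_i := first_coords i (iter k s x).

Let f_period i x k : f i x (k + #|{: 'rV['F_p]_i}|)%N = f i x k.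
Proof.
rewrite /f card_rV_Fp // iterD; apply: first_coords_iter; apply/first_coordsP => l li.
by rewrite triangular_period.
Qed.

Let f_onto i x y : exists k, f i x k = y.
Proof.
have [z <-] := first_coords_onto y; have [k <-] := s_trans x z.
by exists k.
Qed.

Lemma first_coords_iter_eq i x k l :
  first_coords i (iter k s x) = first_coords i (iter l s x) <->
  (k = l %[mod p ^ i])%N.
Proof.
by rewrite -card_rV_Fp //; exact: periodic_eq (@f_period i x) (@f_onto i x) k l.
Qed.

(* Along [p ^ i] steps the first [i] coordinates visit every point of [F_p ^ i]
   exactly once, so coordinate [i] is shifted by the sum of all values of [G i]. *)
Lemma iter_triangular_shift m (i : 'I_n) x :
  iter (m * p ^ i) s x 0 i = x 0 i + (\sum_y G i y) *+ m.
Proof.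
elim: m => [|m IHm]; first by rewrite addr0.
rewrite mulSn iterD iter_triangular IHm mulrSr addrA; congr (_ + _).
rewrite -card_rV_Fp //.
exact: (periodic_sum (@f_period i _) (@f_onto i _)).
Qed.

End Transitive.

End TriangularIteration.

Lemma maximal_orbit_trans (p n : nat) (s : {perm 'rV['F_p]_n}) :
  maximal_orbit s -> forall x y, exists k, iter k s x = y.
Proof.
move=> [C [sC _]] x y.
have orbC z : porbit s z = C.
  by apply/set1P; rewrite -sC; exact: imset_f.
have : y \in porbit s x by rewrite orbC -(orbC y) porbit_id.
by case/porbitP=> k ->; exists k; rewrite permX.
Qed.

(** * Conjugating maps and their membership in [Bn] *)

Section Conjugation.

Variables (p n : nat).
Hypothesis p_pr : prime p.
Variables (sigma tau : {perm 'rV['F_p]_n}) (S T : forall i : 'I_n, R p i).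
Hypothesis sigma_trans : forall x y, exists k, iter k sigma x = y.
Hypothesis tau_trans : forall x y, exists k, iter k tau x = y.
Hypothesis sigmaE : sigma =1 triangular S.
Hypothesis tauE : tau =1 triangular T.

Let S_trans x y : exists k, iter k (triangular S) x = y.
Proof. by have [k <-] := sigma_trans x y; exists k; rewrite (eq_iter sigmaE). Qed.

Let T_trans x y : exists k, iter k (triangular T) x = y.
Proof. by have [k <-] := tau_trans x y; exists k; rewrite (eq_iter tauE). Qed.

Lemma conj_maps_to_iter (phi : {perm 'rV['F_p]_n}) k x :
  conj_maps_to phi sigma tau -> phi (iter k tau x) = iter k sigma (phi x).
Proof. by move=> phiE; elim: k => //= k <-; rewrite -phiE /= permKV. Qed.

Lemma conj_maps_to_unique (phi psi : {perm 'rV['F_p]_n}) :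
  conj_maps_to phi sigma tau -> conj_maps_to psi sigma tau ->
  phi 0 = psi 0 -> phi = psi.
Proof.
move=> phiE psiE phi_psi; apply/permP=> x; have [k <-] := tau_trans 0 x.
by rewrite !conj_maps_to_iter // phi_psi.
Qed.

(** Both sides of phi tau^N = sigma^N phi, with N = p^i, are compared at 0 in coordinate [i]. As
    tau^N restores the first [i] coordinates, the increments of [phi] cancel and only the two shifts
    remain. *)
Lemma conj_Bn_eq_sum (phi : {perm 'rV['F_p]_n}) :
  phi \in Bn p n -> conj_maps_to phi sigma tau ->
  forall i, \sum_y S i y = \sum_y T i y.
Proof.
move=> /Bn_P[g phig] phiE i; pose N := (p ^ i)%N.
have fc0 : first_coords i (iter N tau 0) = first_coords i 0.
  rewrite (eq_iter tauE); apply/first_coordsP=> k ki.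
  by rewrite triangular_period.
have shift_sigma := iter_triangular_shift p_pr S_trans 1 i (phi 0).
have shift_tau := iter_triangular_shift p_pr T_trans 1 i 0.
rewrite mul1n mulr1n -/N -(eq_iter sigmaE) -(eq_iter tauE) in shift_sigma shift_tau.
move: shift_sigma; rewrite -conj_maps_to_iter // !phig ![triangular _ _ _ _]mxE.
rewrite fc0 shift_tau -!addrA => /addrI; rewrite addrC => /addrI; exact: esym.
Qed.

Lemma exists_conj (e : 'rV['F_p]_n) :
  exists phi : {perm 'rV['F_p]_n}, conj_maps_to phi sigma tau /\ phi 0 = e.
Proof.
have tau_log x : exists k, iter k tau 0 == x.
  by have [k <-] := tau_trans 0 x; exists k.
pose log x := xchoose (tau_log x).
have logK x : iter (log x) tau 0 = x by exact/eqP/(xchooseP (tau_log x)).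
(* Both sides mean that [k] and [l] agree modulo p^n; hence the choice of [log] is immaterial and
   [f] is injective. *)
have sigma_tau k l : iter k sigma e = iter l sigma e <-> iter k tau 0 = iter l tau 0.
  rewrite !(eq_iter sigmaE) !(eq_iter tauE).
  exact: iff_trans (iter_triangular_eq p_pr S_trans e k l)
                   (iff_sym (iter_triangular_eq p_pr T_trans 0 k l)).
pose f x := iter (log x) sigma e.
have f_inj : injective f by move=> x y /sigma_tau; rewrite !logK.
exists (perm f_inj); split=> [x /=|]; last first.
  by rewrite permE; apply: (sigma_tau _ 0%N).2; rewrite logK.
(* Applying the permutation removes its inverse; the exponents log x + 1 and log (tau x) then both
   carry 0 to tau x. *)
apply: (perm_inj (s := perm f_inj)); rewrite permKV !permE /f.
by apply: (sigma_tau (log x).+1 _).2; rewrite /= !logK.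
Qed.

Lemma conj_in_Bn (phi : {perm 'rV['F_p]_n}) :
  conj_maps_to phi sigma tau ->
  (forall i, \sum_y S i y = \sum_y T i y) -> phi \in Bn p n.
Proof.
move=> phiE ST.
have phi_sub i x y : first_coords i x = first_coords i y ->
    phi x 0 i - x 0 i = phi y 0 i - y 0 i.
  have [k kx] := tau_trans 0 x; have [l ly] := tau_trans 0 y.
  wlog kl : x y k l kx ly / (k <= l)%N.
    move=> H xy; have [kl|/ltnW lk] := leqP k l; first exact: H kx ly kl xy.
    by symmetry; apply: H ly kx lk _.
  rewrite -kx -ly -{}(subnK kl); set d := (l - k)%N.
  (* Equal first [i] coordinates make [d] a multiple m p^i, so one point is tau^(m p^i) of the
     other. *)
  rewrite !(eq_iter tauE) => /(first_coords_iter_eq p_pr T_trans) /esym/eqP.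
  rewrite -[X in _ == X %[mod _]]add0n eqn_modDr mod0n => /dvdnP[m ->].
  rewrite -!(eq_iter tauE) iterD [phi (iter (m * _) _ _)]conj_maps_to_iter //.
  move: (iter k tau 0) => z.
  rewrite !(eq_iter sigmaE) !(eq_iter tauE).
  rewrite (iter_triangular_shift p_pr S_trans) (iter_triangular_shift p_pr T_trans).
  by rewrite ST opprD addrACA subrr addr0.
rewrite inE; apply/forallP=> i; apply/existsP.
(* By [phi_sub] any preimage of [y] gives the same value; the default 0 is never reached at an
   argument [first_coords i x]. *)
exists [ffun y => let x := odflt 0 [pick x | first_coords i x == y] in phi x 0 i - x 0 i].
apply/forallP=> x; rewrite ffunE; case: pickP => [y /eqP yx|/(_ x)]; last by rewrite eqxx.
by rewrite /= (phi_sub i y x yx) addrC subrK.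
Qed.

End Conjugation.

Theorem proposition2p13 (p n : nat) (hp : prime p) (hn : (1 <= n)%N)
    (sigma tau : {perm 'rV['F_p]_n})
    (sigma_B : sigma \in Bn p n) (tau_B : tau \in Bn p n)
    (sigma_max : maximal_orbit sigma) (tau_max : maximal_orbit tau)
    (lambda mu : 'I_n -> 'F_p) (g h : forall i : 'I_n, R p i)
    (lambda_neq0 : forall i : 'I_n, lambda i != 0)
    (mu_neq0 : forall i : 'I_n, mu i != 0)
    (gP : forall i : 'I_n, g i \in Rminus p i)
    (hP : forall i : 'I_n, h i \in Rminus p i)
    (sigmaE : sigma =1
       triangular (fun i : 'I_n => lambda i *: top_monomial p i + g i))
    (tauE : tau =1
       triangular (fun i : 'I_n => mu i *: top_monomial p i + h i)) :
  ((exists phi : {perm 'rV['F_p]_n},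
      phi \in Bn p n /\ conj_maps_to phi sigma tau) <->
   (forall i : 'I_n, lambda i = mu i)) /\
  ((exists phi : {perm 'rV['F_p]_n},
      phi \in Bn p n /\ conj_maps_to phi sigma tau) ->
   exists! phi : {perm 'rV['F_p]_n},
     [/\ phi \in Bn p n, conj_maps_to phi sigma tau & standard_form phi]).
Proof.
have sigma_trans := maximal_orbit_trans sigma_max.
have tau_trans := maximal_orbit_trans tau_max.
pose e : 'rV['F_p]_n := \row_(i < n) (i == 0 :> nat)%:R.
have conjB i : (exists phi : {perm 'rV['F_p]_n},
      phi \in Bn p n /\ conj_maps_to phi sigma tau) -> lambda i = mu i.
  move=> [phi [phiB phiE]].
  have := conj_Bn_eq_sum hp sigma_trans tau_trans sigmaE tauE phiB phiE i.
  (* The common factor (-1)^i is nonzero and cancels. *)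
  rewrite !sum_top_Rminus //; apply: mulIf.
  by rewrite signr_eq0.
have Bconj : (forall i, lambda i = mu i) -> exists phi : {perm 'rV['F_p]_n},
    [/\ phi \in Bn p n, conj_maps_to phi sigma tau & standard_form phi].
  move=> lm.
  have [phi [phiE phi0]] := exists_conj hp sigma_trans tau_trans sigmaE tauE e.
  exists phi; split=> //.
  apply: (conj_in_Bn hp sigma_trans tau_trans sigmaE tauE phiE) => i.
  by rewrite !sum_top_Rminus // lm.
split; first split=> [ex i|/Bconj[phi [phiB phiE _]]]; first exact: conjB.
  by exists phi.
move=> ex; have [phi [phiB phiE phi0]] := Bconj (fun i => conjB i ex).
exists phi; split=> // psi [_ psiE psi0].
by apply: (conj_maps_to_unique tau_trans phiE psiE); rewrite phi0 psi0.
Qed.
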